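(* Let $U\subset\mathbb{R}^2$ be open, let $A:U\to\mathbb{R}^{2\times 2}$ be a continuously differentiable field of symmetric matrices, and for $\alpha\in\mathbb{R}$ let $A_\alpha(x)=A(x)-\alpha I$ and $g_{x,\alpha}(u,u)=\frac12\langle u,A_\alpha(x)u\rangle$ be the associated Lorentzian metric family. Define $$V=\{x\in U,\ \phi\in\mathbb{S}^1:\ \langle e_\phi,R^\top A(x)e_\phi\rangle\neq 0\}.$$ Then, for any parameter value $\alpha\in\mathbb{R}$, the closed null-geodesics of $g_{x,\alpha}$ coincide with the $x$-projections of closed orbits of the initial value problem, defined on $V$, $$x'=e_\phi,\qquad \phi'=-\frac{\langle e_\phi,(\nabla_xA(x)e_\phi)e_\phi\rangle}{2\langle e_\phi,R^\top A(x)e_\phi\rangle},$$ with initial conditions $(x_0,\phi_0)$ in the set $$\left\{(x_0,\phi_0)\in V:\ \tfrac12\langle e_{\phi_0},(A(x_0)-\alpha I)e_{\phi_0}\rangle=0,\ \phi_0\in\mathbb{S}^1\right\}.$$ Moreover, null-geodesics for a given value of $\alpha$ (lifted to $U\times\mathbb{S}^1$ by their tangent angle $\phi$) lie on the zero level surface of $g_{x,\alpha}(e_\phi,e_\phi)$, $$\mathcal{M}_\alpha=\left\{(x,\phi)\in V:\ \tfrac12\langle e_\phi,(A(x)-\alpha I)e_\phi\rangle=0\right\}.$$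
   Context: Notation: $\langle\cdot,\cdot\rangle$ is the Euclidean inner product on $\mathbb{R}^2$; $I$ is the $2\times2$ identity matrix; $\mathbb{S}^1=\mathbb{R}/2\pi\mathbb{Z}$; $e_\phi=(\cos\phi,\sin\phi)^\top$; $R=\begin{pmatrix}0&-1\\1&0\end{pmatrix}$ is the counterclockwise rotation by ninety degrees. With $A_{ij,k}=\partial_{x_k}A_{ij}$ and summation over repeated indices, $\langle v,(\nabla_xA(x)v)v\rangle=v_iA_{ij,k}(x)v_kv_j$. A prime denotes $d/ds$ with respect to the curve parameter $s$. Geodesics of $g_{x,\alpha}$ are the stationary curves of $\int L\,ds$ with $L(x,x')=\frac12\langle x',A_\alpha(x)x'\rangle$, i.e. the solutions $x(s)$ of the Euler--Lagrange equations $\frac12\nabla_x\langle x',A_\alpha(x)x'\rangle-\frac{d}{ds}[A_\alpha(x)x']=0$. A null-geodesic is a geodesic with nonvanishing tangent vector $x'(s)$ along which $g_{x,\alpha}(x',x')\equiv0$. The metric is considered where it is Lorentzian, i.e. where $A_\alpha(x)$ is nondegenerate and indefinite. Null-geodesics are regarded as oriented curves up to reparametrization (the parameter $s$ may be rescaled along each curve), and a closed null-geodesic is one whose underlying curve is a closed regular curve in $U$. The tangent angle $\phi\in\mathbb{S}^1$ of a null-geodesic is defined by $x'=\rho e_\phi$ with $\rho>0$. Closed orbits of the initial value problem are periodic orbits in $V\subset U\times\mathbb{S}^1$, and the $x$-projection is the map $(x,\phi)\mapsto x$. *)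

(* Defs.v *)
From HB Require Import structures.
From mathcomp Require Import all_boot all_order all_algebra.
From mathcomp Require Import all_classical all_reals all_analysis.
Set Implicit Arguments.
Unset Strict Implicit.
Unset Printing Implicit Defensive.
Import Order.TTheory GRing.Theory Num.Theory.
Import numFieldNormedType.Exports.
Local Open Scope ring_scope.
Local Open Scope classical_set_scope.

Section PlaneFields.
Context {R : realType}.
Implicit Types (U : set 'cV[R]_2) (A : 'cV[R]_2 -> 'M[R]_2) (alpha : R).

Definition dotp (u v : 'cV[R]_2) : R := \sum_i u i 0 * v i 0.

Definition basis_vec (k : 'I_2) : 'cV[R]_2 := delta_mx k 0.

Definition unit_vec (phi : R) : 'cV[R]_2 :=
  \col_i (if i == 0 then cos phi else sin phi).

Definition rot90 : 'M[R]_2 :=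
  \matrix_(i, j) (if i == j then 0 else if i == 0 then - 1 else 1).

Definition C1_field U A : Prop :=
  forall x, U x ->
    differentiable A x /\ forall v, {for x, continuous (fun y => 'D_v A y)}.

(* (nabla_x A(x) v)_ij = sum_k A_ij,k v_k *)
Definition nabla_field A (x v : 'cV[R]_2) : 'M[R]_2 :=
  \matrix_(i, j) \sum_k 'D_(basis_vec k) (fun y => A y i j) x * v k 0.

Definition shifted A alpha (x : 'cV[R]_2) : 'M[R]_2 := A x - alpha%:M.

Definition metric_form A alpha (x u : 'cV[R]_2) : R :=
  2^-1 * dotp u (shifted A alpha x *m u).

Definition indefinite (B : 'M[R]_2) : Prop :=
  (exists u, 0 < dotp u (B *m u)) /\ (exists v, dotp v (B *m v) < 0).

Definition lorentzian_at A alpha (x : 'cV[R]_2) : Prop :=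
  shifted A alpha x \in unitmx /\ indefinite (shifted A alpha x).

Definition gradient (f : 'cV[R]_2 -> R) (x : 'cV[R]_2) : 'cV[R]_2 :=
  \col_k 'D_(basis_vec k) f x.

(* A parametrized plane curve on a nonempty open interval, possibly bounded or
   a half-line: a null-geodesic with closed image need not be complete, its
   velocity may be multiplied by a factor at each turn.  The values of
   [curve_fun] outside [curve_dom] are irrelevant. *)
Record curve := Curve {
  curve_dom : set R;
  curve_fun :> R -> 'cV[R]_2;
  curve_dom_open : open curve_dom;
  curve_dom_itv : is_interval curve_dom;
  curve_dom_neq0 : curve_dom !=set0 }.

Lemma is_intervalT : is_interval [set: R].
Proof. by []. Qed.

Lemma setT_neq0 : [set: R] !=set0.
Proof. by exists 0. Qed.

Definition line_curve (c : R -> 'cV[R]_2) : curve :=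
  Curve c openT is_intervalT setT_neq0.

(* [p] is [q] composed with an orientation-preserving C^1 diffeomorphism
   between their domains. *)
Definition reparam (p q : curve) : Prop :=
  exists theta : R -> R,
    [/\ theta @` curve_dom p = curve_dom q,
        forall s, curve_dom p s ->
          [/\ derivable theta s 1, 0 < theta^`() s
            & {for s, continuous theta^`()}]
      & forall s, curve_dom p s -> p s = q (theta s)].

Definition oriented_curve (p : curve) : set curve := [set q | reparam p q].

Definition velocity (x : curve) : R -> 'cV[R]_2 := derive1 x.

Definition geodesic U A alpha (x : curve) : Prop :=
  forall s, curve_dom x s ->
    let momentum := fun t => shifted A alpha (x t) *m velocity x t in
    let v := velocity x s in
    [/\ U (x s), lorentzian_at A alpha (x s),
        derivable x s 1, derivable momentum s 1
      & 2^-1 *: gradient (fun y => dotp v (shifted A alpha y *m v)) (x s)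
          - derive1 momentum s = 0].

Definition null_geodesic U A alpha (x : curve) : Prop :=
  geodesic U A alpha x /\
  forall s, curve_dom x s ->
    velocity x s != 0 /\
    metric_form A alpha (x s) (velocity x s) = 0.

Definition closed_regular_curve U (c : R -> 'cV[R]_2) : Prop :=
  [/\ forall s, U (c s),
      forall s, derivable c s 1 /\ c^`() s != 0,
      continuous c^`()
    & exists2 T, 0 < T & forall s, c (s + T) = c s].

Definition closed_null_geodesics U A alpha : set (set curve) :=
  [set Gamma | exists p, [/\ null_geodesic U A alpha p,
     Gamma = oriented_curve p
   & exists2 c, closed_regular_curve U c & Gamma (line_curve c)]].

(* Points of S^1 = R / 2 pi Z are given by real representatives; [angle_eq] is
   equality in S^1, and subsets of U x S^1 are given as subsets of U x R that
   are 2 pi-periodic in the second variable. *)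
Definition angle_eq (a b : R) : Prop := exists k : int, a = b + k%:~R * (2 * pi).

Definition transversality A (z : 'cV[R]_2 * R) : R :=
  dotp (unit_vec z.2) (rot90^T *m A z.1 *m unit_vec z.2).

Definition phase_domain U A : set ('cV[R]_2 * R) :=
  [set z | U z.1 /\ transversality A z != 0].

Definition level_surface U A alpha : set ('cV[R]_2 * R) :=
  [set z | phase_domain U A z /\ metric_form A alpha z.1 (unit_vec z.2) = 0].

Definition angular_speed A (z : 'cV[R]_2 * R) : R :=
  let e := unit_vec z.2 in
  - (dotp e (nabla_field A z.1 e *m e) / (2 * transversality A z)).

Definition ivp_solution U A alpha (x : R -> 'cV[R]_2) (phi : R -> R) : Prop :=
  level_surface U A alpha (x 0, phi 0) /\
  forall s, [/\ phase_domain U A (x s, phi s),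
    is_derive s 1 x (unit_vec (phi s))
  & is_derive s 1 phi (angular_speed A (x s, phi s))].

Definition closed_orbit U A alpha (x : R -> 'cV[R]_2) (phi : R -> R) : Prop :=
  ivp_solution U A alpha x phi /\
  exists2 T, 0 < T &
    forall s, x (s + T) = x s /\ angle_eq (phi (s + T)) (phi s).

Definition closed_orbit_projections U A alpha : set (set curve) :=
  [set Gamma | exists x phi,
     closed_orbit U A alpha x phi /\ Gamma = oriented_curve (line_curve x)].

Definition tangent_angle (x : curve) (s phi : R) : Prop :=
  exists2 rho, 0 < rho & velocity x s = rho *: unit_vec phi.

Definition tangent_lift (x : curve) : set ('cV[R]_2 * R) :=
  [set z | exists2 s, curve_dom x s & z.1 = x s /\ tangent_angle x s z.2].

End PlaneFields.

(* Main.v *)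
(* With J the rotation by ninety degrees, an isotropic unit vector e of
   A_alpha satisfies A_alpha e = tau J e, where tau = <J e, A e> is the
   denominator of the initial value problem; so tau <> 0 exactly where A_alpha
   is nondegenerate, and alpha drops out of the equations.  Differentiating
   <e, A_alpha e> = 0 along a curve with unit tangent e gives the equation for
   phi', and conversely that equation makes <e, A_alpha e> constant.

   From null-geodesics to orbits, parametrize the closed curve by arc length.
   The Euler-Lagrange equations are needed only for the differentiability of
   the momentum: A_alpha being invertible, the tangent is then differentiable,
   and its angle is recovered by integrating its rate of rotation.

   From orbits to null-geodesics, run through the curve with speed r.  The
   momentum is r tau J e, so the component of the Euler-Lagrange equations
   along e is the equation for phi', while the component along J e is a linear
   equation for r tau, solved by an exponential. *)

Require Import Defs.
From mathcomp Require Import all_boot all_order all_algebra.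
From mathcomp Require Import all_classical all_reals all_analysis.
From mathcomp Require Import ring lra.
Import Order.TTheory GRing.Theory Num.Theory.
Import numFieldNormedType.Exports.
Local Open Scope ring_scope.
Local Open Scope classical_set_scope.

(** * Calculus on the real line *)

Section RealFunctions.
Context {R : realType}.
Implicit Types (f g h : R -> R) (D : set R).

Lemma is_derive_derive1 {V : normedModType R} (f : R -> V) (x : R) :
  derivable f x 1 -> is_derive x 1 f (derive1 f x).
Proof. by move=> df; rewrite derive1E; exact/derivableP. Qed.

Lemma is_derive_continuous {V : normedModType R} (f : R -> V) (x : R) (l : V) :
  is_derive x 1 f l -> {for x, continuous f}.
Proof.
by move=> [df _]; exact/differentiable_continuous/derivable1_diffP.
Qed.

Lemma is_derive_itv_continuous f (df : R -> R) (a b : R) :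
  (forall x, x \in `[a, b]%R -> is_derive x 1 f (df x)) ->
  {within `[a, b], continuous f}.
Proof.
by move=> fd; apply: derivable_within_continuous => x xab; have [] := fd _ xab.
Qed.

Lemma is_derive0_itv_cst D f : is_interval D ->
  (forall x, D x -> is_derive x 1 f 0) -> forall x y, D x -> D y -> f x = f y.
Proof.
move=> Ditv fd x y; wlog xy : x y / x <= y.
  by move=> H Dx Dy; case: (leP x y) => [/H|/ltW /H] ->.
move=> Dx Dy.
have Dxy z : z \in `[x, y]%R -> D z by rewrite in_itv/=; exact: Ditv.
have [||z _] := @MVT_segment R f (fun=> 0) x y xy.
- by move=> z zxy; apply/fd/Dxy; exact: subset_itv_oo_cc.
- by apply: (@is_derive_itv_continuous _ (fun=> 0)) => z /Dxy/fd.
- by rewrite mul0r => /eqP; rewrite subr_eq0 => /eqP.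
Qed.

Lemma is_derive_gt0_itv_incr D f (df : R -> R) : is_interval D ->
  (forall x, D x -> is_derive x 1 f (df x)) -> (forall x, D x -> 0 < df x) ->
  forall x y, D x -> D y -> x < y -> f x < f y.
Proof.
move=> Ditv fd df0 x y Dx Dy xy.
have Dxy z : z \in `[x, y]%R -> D z by rewrite in_itv/=; exact: Ditv.
have [||z zxy] := @MVT R f df x y xy.
- by move=> z zxy; apply/fd/Dxy; exact: subset_itv_oo_cc.
- by apply: (@is_derive_itv_continuous _ df) => z /Dxy/fd.
- have Dz : D z by apply/Dxy; exact: subset_itv_oo_cc zxy.
  by rewrite -subr_gt0 => ->; rewrite mulr_gt0 ?subr_gt0// df0.
Qed.

(** The integrals of [h] from [- n], normalized to vanish at 0, have derivative [h] to the right of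
    [- n]. Any two of them agree where both are defined, so they glue to a primitive on the whole
    line. *)
Lemma continuous_primitive h : continuous h ->
  exists H : R -> R, forall x : R, is_derive x 1 H (h x).
Proof.
move=> hc.
pose F (n : nat) (x : R) : R :=
  \int[lebesgue_measure]_(t in `[- n%:R, x]) h t.
have Fd n (x : R) : - n%:R < x -> is_derive x 1 (F n) (h x).
  move=> nx; have xx1 : x < x + 1 by rewrite ltrDl.
  have hi : lebesgue_measure.-integrable `[(- n%:R : R), x + 1] (EFin \o h).
    apply: continuous_compact_integrable; first exact: segment_compact.
    exact/continuous_subspaceT/hc.
  have [dF FE] := continuous_FTC1_closed xx1 hi nx (hc x).
  by rewrite -FE; exact: is_derive_derive1.
pose G n x := F n x - F n 0.
have Gd n (x : R) : - n%:R < x -> is_derive x 1 (G n) (h x).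
  move=> /Fd Fnx; rewrite -[h x]subr0.
  exact: (@is_deriveB _ _ _ (F n) (cst (F n 0))).
(* With successors, 0 lies strictly inside both domains, and there both functions vanish. *)
have GE n m (x : R) : - n.+1%:R < x -> - m.+1%:R < x -> G n.+1 x = G m.+1 x.
  move=> nx mx.
  pose D := [set z : R | - n.+1%:R < z /\ - m.+1%:R < z].
  have D0 : D 0 by split; rewrite oppr_lt0 ltr0n.
  have Dx : D x by [].
  have : (G n.+1 - G m.+1) x = (G n.+1 - G m.+1) 0.
    apply: (is_derive0_itv_cst D) => // [y z [yn ym] _ u /andP[yu _]|z [zn zm]].
      by split; [exact: lt_le_trans yu|exact: lt_le_trans yu].
    by rewrite -(subrr (h z)); apply: is_deriveB; exact: Gd.
  by rewrite !fctE /G !subrr => /eqP; rewrite subr_eq0 => /eqP.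
pose N (x : R) := (Num.truncn `|x|).+1.
have NP (x z : R) : `|z| < (N x)%:R -> - (N x)%:R < z.
  by rewrite ltr_norml => /andP[].
exists (fun x => G (N x) x) => x.
have xN : `|x| < (N x)%:R by exact: truncnS_gt.
(* The index [N z] varies with [z], but near [x] it may be replaced by the fixed index [N x]. *)
apply: (@near_eq_is_derive _ _ _ (G (N x))); last exact/Gd/NP.
have : \forall z \near x, `|z| < (N x)%:R.
  have : \forall y \near `|x|, y < (N x)%:R by exact: lt_nbhsl.
  exact: norm_continuous.
by apply: filterS => z zN; apply: GE; apply: NP => //; exact: truncnS_gt.
Qed.

End RealFunctions.

(** * Curves up to orientation-preserving reparametrization *)

Section Reparametrization.
Context {R : realType}.
Implicit Types (p q r : @curve R) (D E : set R).

(** A positive derivative makes [f] strictly increasing, hence injective. The inverse function rule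
    gives the derivative of [g], which is continuous as a composite of [df], [g] and inversion. *)
Lemma increasing_C1_inverse D E (f df : R -> R) :
  open D -> is_interval D -> f @` D = E ->
  (forall s, D s -> [/\ is_derive s 1 f (df s), 0 < df s
                      & {for s, continuous df}]) ->
  exists g : R -> R,
    [/\ g @` E = D, forall s, D s -> g (f s) = s, forall t, E t -> f (g t) = t
      & forall t, E t ->
         [/\ is_derive t 1 g (df (g t))^-1, 0 < (df (g t))^-1
           & {for t, continuous (fun t => (df (g t))^-1)}]].
Proof.
move=> Dop Ditv fDE fP.
have fincr x y : D x -> D y -> x < y -> f x < f y.
  by apply: (@is_derive_gt0_itv_incr _ _ _ df) => // z /fP[].
have finj x y : D x -> D y -> f x = f y -> x = y.
  move=> Dx Dy fxy; apply/eqP; case: ltgtP => // /fincr.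
    by move=> /(_ Dx Dy); rewrite fxy ltxx.
  by move=> /(_ Dy Dx); rewrite fxy ltxx.
have /choice[g gP] : forall t, exists s, E t -> D s /\ f s = t.
  move=> t; have [Et|] := pselect (E t); last by exists 0.
  by move: (Et); rewrite -{1}fDE => -[s Ds fs]; exists s.
have Ef s : D s -> E (f s) by rewrite -fDE => Ds; exists s.
have gf s : D s -> g (f s) = s.
  by move=> Ds; have [Dg fg] := gP _ (Ef _ Ds); exact: finj.
have fg t : E t -> f (g t) = t by move=> /gP[].
have Dg t : E t -> D (g t) by move=> /gP[].
have gd t : E t -> is_derive t 1 g (df (g t))^-1.
  move=> Et; have Dgt := Dg _ Et; have [fd df0 _] := fP _ Dgt.
  have nD : \forall z \near g t, D z by exact: open_nbhs_nbhs.
  rewrite -[X in is_derive X](fg _ Et).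
  apply: is_derive_inverse fd _; last exact: lt0r_neq0.
  - by apply: filterS nD => z; exact: gf.
  - by apply: filterS nD => z /fP[] /is_derive_continuous.
exists g; split => // [|t Et].
  apply/seteqP; split => [_ [t Et <-]|s Ds]; first exact: Dg.
  by exists (f s); [exact: Ef|exact: gf].
have [_ df0 dfc] := fP _ (Dg _ Et).
split; [exact: gd|by rewrite invr_gt0|].
apply: (@continuousV _ _ (df \o g)); first exact: lt0r_neq0.
apply: continuous_comp dfc.
by have := gd _ Et; exact: is_derive_continuous.
Qed.

(** Lets the derivative be given by any formula [df] valid on the domain: since the domain is open,
    [df] and the derivative agree near each of its points, and continuity carries over. *)
Lemma reparamP p q (f df : R -> R) :
  f @` curve_dom p = curve_dom q ->
  (forall s, curve_dom p s ->
     [/\ is_derive s 1 f (df s), 0 < df s & {for s, continuous df}]) ->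
  (forall s, curve_dom p s -> p s = q (f s)) -> reparam p q.
Proof.
move=> fpq fP pq; exists f; split => // s ps.
have fE t : curve_dom p t -> f^`() t = df t.
  by move=> /fP[[_ +] _ _]; rewrite derive1E.
have [[fd _] df0 dfc] := fP _ ps.
split; [by []|by rewrite fE|].
have nE : \forall t \near s, df t = f^`() t.
  apply: (@filterS _ _ _ (curve_dom p)) => [t /fE//|].
  apply: open_nbhs_nbhs; split => //; exact: curve_dom_open.
rewrite /prop_for/continuous_at fE//.
by apply: cvg_trans dfc; exact: near_eq_cvg.
Qed.

Lemma reparam_exists p q : reparam p q ->
  exists f df : R -> R, [/\ f @` curve_dom p = curve_dom q,
    forall s, curve_dom p s ->
     [/\ is_derive s 1 f (df s), 0 < df s & {for s, continuous df}] &
    forall s, curve_dom p s -> p s = q (f s)].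
Proof.
move=> [f [fpq fP pq]]; exists f, f^`(); split => [//|s /fP[fd f0 fc]|//].
by split; [exact: is_derive_derive1|exact: f0|exact: fc].
Qed.

Lemma reparam_refl p : reparam p p.
Proof.
apply: (@reparamP _ _ id (fun=> 1)) => //; first by rewrite image_id.
by move=> s _; split; [exact: is_derive_id|exact: ltr01|exact: cst_continuous].
Qed.

Lemma reparam_sym p q : reparam p q -> reparam q p.
Proof.
move=> /reparam_exists[f [df [fpq fP pq]]].
have [g [gE gf fg gP]] := increasing_C1_inverse _ _ _ _
  (@curve_dom_open _ p) (@curve_dom_itv _ p) fpq fP.
apply: (reparamP _ _ g _ gE gP) => t qt.
rewrite -[in LHS](fg _ qt) -pq//.
by rewrite -gE; exists t.
Qed.

Lemma reparam_trans q p r : reparam p q -> reparam q r -> reparam p r.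
Proof.
move=> /reparam_exists[f [df [fE fP pq]]] /reparam_exists[g [dg [gE gP qr]]].
have qf s : curve_dom p s -> curve_dom q (f s) by rewrite -fE => ps; exists s.
apply: (@reparamP _ _ (g \o f) (fun s => dg (f s) * df s)).
- by rewrite -gE -fE image_comp.
- move=> s ps; have [fd df0 dfc] := fP _ ps.
  have [gd dg0 dgc] := gP _ (qf _ ps).
  split; [exact: is_derive1_comp|exact: mulr_gt0|].
  apply: (@continuousM _ _ (dg \o f)) => //; apply: continuous_comp => //.
  exact: is_derive_continuous fd.
- by move=> s ps; rewrite pq// qr//; exact: qf.
Qed.

Lemma oriented_curve_eq p q :
  reparam p q -> oriented_curve p = oriented_curve q.
Proof.
move=> pq; apply/seteqP; split => r /=.
  exact/reparam_trans/reparam_sym.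
exact: reparam_trans.
Qed.

End Reparametrization.

(** * Linear algebra and calculus in the plane *)

Section PlaneVectors.
Context {R : realType}.
Implicit Types (u v w e : 'cV[R]_2) (B : 'M[R]_2).

Lemma big_ord2 {V : nmodType} (F : 'I_2 -> V) : \sum_i F i = F 0 + F 1.
Proof.
by rewrite big_ord_recl big_ord1; congr (_ + F _); exact: val_inj.
Qed.

Lemma dotpE u v : dotp u v = u 0 0 * v 0 0 + u 1 0 * v 1 0.
Proof. exact: big_ord2. Qed.

Lemma mulmx2E {m n} (M : 'M[R]_(m, 2)) (N : 'M[R]_(2, n)) i j :
  (M *m N) i j = M i 0 * N 0 j + M i 1 * N 1 j.
Proof. by rewrite mxE big_ord2. Qed.

Lemma rot90_mul0 u : (rot90 *m u) 0 0 = - u 1 0.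
Proof. by rewrite mulmx2E !mxE/=; ring. Qed.

Lemma rot90_mul1 u : (rot90 *m u) 1 0 = u 0 0.
Proof. by rewrite mulmx2E !mxE/=; ring. Qed.

Lemma cV2P u v : u 0 0 = v 0 0 -> u 1 0 = v 1 0 -> u = v.
Proof.
move=> uv0 uv1; apply/matrixP => i j; rewrite ord1.
case: i => -[|[|//]] ilt.
  by rewrite (_ : Ordinal ilt = 0)//; exact: val_inj.
by rewrite (_ : Ordinal ilt = 1)//; exact: val_inj.
Qed.

Lemma det_mx2 B : \det B = B 0 0 * B 1 1 - B 0 1 * B 1 0.
Proof.
rewrite (expand_det_row _ 0) big_ord2 /cofactor !det_mx11 !mxE/=.
rewrite expr0 expr1 mul1r mulN1r mulrN.
by congr (_ * B _ _ - _ * B _ _); exact: val_inj.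
Qed.

Lemma addmxE {m n} (M N : 'M[R]_(m, n)) i j : (M + N) i j = M i j + N i j.
Proof. by rewrite mxE. Qed.

Lemma scalemxE {m n} (k : R) (M : 'M[R]_(m, n)) i j : (k *: M) i j = k * M i j.
Proof. by rewrite mxE. Qed.

Lemma oppmxE {m n} (M : 'M[R]_(m, n)) i j : (- M) i j = - M i j.
Proof. by rewrite mxE. Qed.

(** Turns identities between plane vectors and matrices into polynomial identities in the
    coordinates, to be closed by [ring]. *)
Definition plane_simp :=
  (dotpE, rot90_mul0, rot90_mul1, @mulmx2E, @addmxE, @oppmxE, @scalemxE).

Lemma dotp_ge0 u : 0 <= dotp u u.
Proof. by rewrite dotpE; nra. Qed.

Lemma dotp_gt0 u : u != 0 -> 0 < dotp u u.
Proof.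
move=> u0; rewrite lt_def dotp_ge0 andbT; apply: contraNneq u0.
rewrite dotpE -!expr2 => /eqP; rewrite paddr_eq0 ?sqr_ge0// !sqrf_eq0.
by move=> /andP[/eqP u0 /eqP u1]; apply/eqP/cV2P; rewrite mxE.
Qed.

Lemma dotp_unit_vec phi : dotp (unit_vec phi) (unit_vec phi) = 1 :> R.
Proof. by rewrite dotpE !mxE/= -!expr2 cos2Dsin2. Qed.

Lemma unit_vec_neq0 phi : unit_vec phi != 0 :> 'cV[R]_2.
Proof.
apply/eqP => e0; have := dotp_unit_vec phi.
by rewrite e0 dotpE !mxE !mul0r addr0 => /esym/eqP; rewrite oner_eq0.
Qed.

Lemma frame_decomposition e w : dotp e e = 1 ->
  w = dotp e w *: e + dotp (rot90 *m e) w *: (rot90 *m e).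
Proof.
(* Multiplying the left side by 1 = <e, e> makes the identity hold for polynomials, without a side
   condition. *)
by move=> e1; apply: cV2P; rewrite -[LHS]mul1r -e1 !plane_simp; ring.
Qed.

Lemma symmetric_offdiag B : B^T = B -> B 1 0 = B 0 1.
Proof. by move=> Bs; rewrite -[in LHS]Bs mxE. Qed.

Lemma dotpZ (k : R) B u :
  dotp (k *: u) (B *m (k *: u)) = k ^+ 2 * dotp u (B *m u).
Proof. by rewrite !plane_simp; ring. Qed.

Lemma null_vector_image B e : dotp e e = 1 -> dotp e (B *m e) = 0 ->
  B *m e = dotp (rot90 *m e) (B *m e) *: (rot90 *m e).
Proof.
move=> e1 eBe; rewrite {1}(frame_decomposition e (B *m e))//.
by rewrite eBe scale0r add0r.
Qed.

(** Since B e is a multiple of J e, a zero coefficient would put e in the kernel of B. *)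
Lemma unitmx_null_vector B e : B \in unitmx -> dotp e e = 1 ->
  dotp e (B *m e) = 0 -> dotp (rot90 *m e) (B *m e) != 0.
Proof.
move=> Bu e1 eBe; apply/eqP => JeBe.
have Be0 : B *m e = 0 by rewrite null_vector_image// JeBe scale0r.
have e0 : e = 0 by rewrite -(mulKmx Bu e) Be0 mulmx0.
by move: e1; rewrite e0 dotpE !mxE !mul0r addr0 => /esym/eqP; rewrite oner_eq0.
Qed.

(** In the orthonormal frame (e, J e) the form has the entries 0, tau, tau, c. Its determinant is -
    tau^2, and it takes both signs near e. *)
Lemma null_vector_lorentzian B e : B^T = B -> dotp e e = 1 ->
  dotp e (B *m e) = 0 -> dotp (rot90 *m e) (B *m e) != 0 ->
  B \in unitmx /\ indefinite B.
Proof.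
move=> Bs e1 eBe; set tau := dotp _ _ => tau0.
have tau2 : 0 < tau ^+ 2 by rewrite exprn_even_gt0.
have B10 := symmetric_offdiag _ Bs.
split.
  have detE : \det B * dotp e e ^+ 2 =
      dotp e (B *m e) * dotp (rot90 *m e) (B *m (rot90 *m e)) - tau ^+ 2.
    by rewrite /tau det_mx2 !plane_simp B10; ring.
  move: detE; rewrite e1 eBe expr1n mulr1 mul0r sub0r => detE.
  by rewrite unitmxE unitfE detE oppr_eq0 lt0r_neq0.
set c := dotp (rot90 *m e) (B *m (rot90 *m e)).
(* Chosen so that |k c| < 1: at e + t J e with t = k tau or t = - k tau, the term 2 t tau then
   dominates t^2 c. *)
pose k := (1 + `|c|)^-1.
have c1 : 0 < 1 + `|c| by rewrite ltr_pwDl.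
have k0 : 0 < k by rewrite invr_gt0.
have kc : `|k * c| < 1.
  rewrite normrM gtr0_norm// /k mulrC ltr_pdivrMr// mul1r; lra.
have QE (t : R) : dotp (e + t *: (rot90 *m e)) (B *m (e + t *: (rot90 *m e))) =
    2 * t * tau + t ^+ 2 * c.
  by rewrite -[RHS]add0r -eBe /tau /c !plane_simp B10; ring.
move: kc; rewrite ltr_norml => /andP[kc1 kc2].
split; [exists (e + (k * tau) *: (rot90 *m e))|
  exists (e + (- k * tau) *: (rot90 *m e))].
  rewrite QE (_ : _ + _ = k * tau ^+ 2 * (2 + k * c)); last by ring.
  by apply: mulr_gt0; [exact: mulr_gt0|lra].
rewrite QE (_ : _ + _ = - (k * tau ^+ 2 * (2 - k * c))); last by ring.
by rewrite oppr_lt0; apply: mulr_gt0; [exact: mulr_gt0|lra].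
Qed.

End PlaneVectors.

(** * Product and chain rules for matrix-valued maps *)

Section MatrixCalculus.
Context {R : realType}.

Lemma is_derive_mxP {V : normedModType R} {m n} (M : V -> 'M[R]_(m, n))
    (t v : V) (dM : 'M[R]_(m, n)) :
  is_derive t v M dM <-> forall i j, is_derive t v (fun x => M x i j) (dM i j).
Proof.
split=> [[Md <-] i j|Md].
  apply: DeriveDef; first by have /derivable_mxP := Md; apply.
  by rewrite derive_mx// mxE.
have dvM : derivable M t v.
  by apply/derivable_mxP => i j; have [] := Md i j.
apply: DeriveDef => //; rewrite derive_mx//; apply/matrixP => i j; rewrite mxE.
by have [] := Md i j.
Qed.

Lemma is_derive_add_cst {V W : normedModType R} (f : V -> W) (c : W)
    (t v : V) df :
  is_derive t v f df -> is_derive t v (fun y => f y + c) df.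
Proof.
by move=> fd; rewrite -[df]addr0; exact: (@is_deriveD _ _ _ f (cst c)).
Qed.

Lemma is_derive_mul {V : normedModType R} (f g : V -> R) (t v : V) (df dg : R) :
  is_derive t v f df -> is_derive t v g dg ->
  is_derive t v (fun x => f x * g x) (df * g t + f t * dg).
Proof.
move=> fd gd; apply: is_derive_eq.
by rewrite /GRing.scale/=; ring.
Qed.

Lemma is_derive_mulmx {V : normedModType R} {m n p} (M : V -> 'M[R]_(m, n))
    (N : V -> 'M[R]_(n, p)) (t v : V) dM dN :
  is_derive t v M dM -> is_derive t v N dN ->
  is_derive t v (fun x => M x *m N x) (dM *m N t + M t *m dN).
Proof.
move=> /is_derive_mxP Md /is_derive_mxP Nd; apply/is_derive_mxP => i j.
rewrite (_ : (fun _ => _) = \sum_k (fun x => M x i k * N x k j)); last first.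
  by apply/funext => x; rewrite mxE fct_sumE.
rewrite !mxE -big_split/=; apply: is_derive_sum => k.
exact: is_derive_mul.
Qed.

Lemma is_derive_dotp {V : normedModType R} (f g : V -> 'cV[R]_2)
    (t v : V) df dg :
  is_derive t v f df -> is_derive t v g dg ->
  is_derive t v (fun x => dotp (f x) (g x)) (dotp df (g t) + dotp (f t) dg).
Proof.
move=> /is_derive_mxP fd /is_derive_mxP gd.
rewrite (_ : (fun _ => _) = \sum_k (fun x => f x k 0 * g x k 0)); last first.
  by apply/funext => x; rewrite fct_sumE.
rewrite /dotp -big_split/=; apply: is_derive_sum => k.
exact: is_derive_mul.
Qed.

Lemma is_derive_scale {V : normedModType R} (f : V -> R) (g : V -> 'cV[R]_2)
    (t v : V) df dg :
  is_derive t v f df -> is_derive t v g dg ->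
  is_derive t v (fun x => f x *: g x) (df *: g t + f t *: dg).
Proof.
move=> fd /is_derive_mxP gd; apply/is_derive_mxP => i j.
rewrite (_ : (fun _ => _) = fun x => f x * g x i j); last first.
  by apply/funext => x; rewrite mxE.
by rewrite !mxE; exact: is_derive_mul.
Qed.

Lemma is_derive_comp_curve {V : normedModType R} (g : R -> V) (f : R -> R)
    (s df : R) dg :
  is_derive (f s) 1 g dg -> is_derive s 1 f df ->
  is_derive s 1 (g \o f) (df *: dg).
Proof.
move=> [gd gE] [fd fE].
have gdiff := (derivable1_diffP _ _).1 gd.
have fdiff := (derivable1_diffP _ _).1 fd.
apply: DeriveDef; first exact/derivable1_diffP/differentiable_comp.
rewrite deriveE; last exact/differentiable_comp.
rewrite diff_comp// [in LHS]/= -(deriveE _ fdiff) fE.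
(* The differential of [g] is linear, so its value at [df] is [df] times its value at 1. *)
by rewrite -gE (deriveE _ gdiff) -linearZ/= [_ *: _]mulr1.
Qed.

Lemma is_derive_unit_vec (phi : R -> R) (s l : R) : is_derive s 1 phi l ->
  is_derive s 1 (fun t => unit_vec (phi t)) (l *: (rot90 *m unit_vec (phi s))).
Proof.
move=> pd; have cosd := is_derive1_comp (is_derive_cos (phi s)) pd.
have sind := is_derive1_comp (is_derive_sin (phi s)) pd.
apply/is_derive_mxP => i j; rewrite (ord1 j).
have -> : (fun t => unit_vec (phi t) i 0) =
    if i == 0 then cos \o phi else sin \o phi.
  by apply/funext => t; rewrite mxE; case: ifP.
case: ifPn => i0.
  rewrite (eqP i0) !plane_simp !mxE/=; apply: is_derive_eq cosd _; ring.
have -> : i = 1 by case: i i0 => -[|[|//]] ? //= _; exact: val_inj.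
by rewrite !plane_simp !mxE/=; apply: is_derive_eq sind _; ring.
Qed.

End MatrixCalculus.

(** * Derivatives of the matrix field, in fixed directions and along curves *)

Section FieldCalculus.
Context {R : realType}.
Implicit Types (A : 'cV[R]_2 -> 'M[R]_2) (x v w : 'cV[R]_2).

Lemma basis_decomposition v : v = \sum_k v k 0 *: basis_vec k.
Proof.
apply/matrixP => i j; rewrite (ord1 j) summxE.
rewrite (bigD1 i)//= !mxE !eqxx mulr1 big1 ?addr0// => k ki.
by rewrite !mxE eq_sym (negbTE ki) mulr0.
Qed.

Lemma derive_basis {W : normedModType R} (f : 'cV[R]_2 -> W) x v :
  differentiable f x -> 'D_v f x = \sum_k v k 0 *: 'D_(basis_vec k) f x.
Proof.
move=> fd; rewrite deriveE// {1}(basis_decomposition v) linear_sum.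
by apply: eq_bigr => k _; rewrite linearZ/= deriveE.
Qed.

(** For a differentiable field the directional derivative is linear in the direction, so the sum
    over coordinates in [nabla_field] computes it. *)
Lemma nabla_fieldE A x v : differentiable A x -> nabla_field A x v = 'D_v A x.
Proof.
move=> Ad; rewrite derive_basis//; apply/matrixP => i j.
rewrite mxE summxE; apply: eq_bigr => k _.
by rewrite mxE mulrC derive_mx ?mxE//; exact: diff_derivable.
Qed.

Lemma is_derive_field A (c : R -> 'cV[R]_2) (s : R) v :
  differentiable A (c s) -> is_derive s 1 c v ->
  is_derive s 1 (fun t => A (c t)) (nabla_field A (c s) v).
Proof.
move=> Ad [cd <-]; have cdiff := (derivable1_diffP _ _).1 cd.
apply: DeriveDef; first exact/derivable1_diffP/(differentiable_comp cdiff Ad).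
rewrite nabla_fieldE// deriveE; last exact: (differentiable_comp cdiff Ad).
by rewrite (diff_comp cdiff Ad)/= -(deriveE _ cdiff) -(deriveE _ Ad).
Qed.

(** The components of the force term in the Euler-Lagrange equations. The vector [v] is frozen, and
    the constant multiple of the identity has derivative zero. *)
Lemma dotp_gradient A alpha x v w : differentiable A x ->
  dotp w (gradient (fun y => dotp v (shifted A alpha y *m v)) x) =
  dotp v (nabla_field A x w *m v).
Proof.
move=> Ad.
have Fd u : is_derive x u (fun y => dotp v (shifted A alpha y *m v))
    (dotp v ('D_u A x *m v)).
  have Aud : is_derive x u A ('D_u A x) by exact/derivableP/diff_derivable.
  have vd : is_derive x u (fun=> v) 0 by exact: is_derive_cst.
  have := is_derive_dotp _ _ _ _ _ _ vd
    (is_derive_mulmx _ _ _ _ _ _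
      (is_derive_add_cst _ (- alpha%:M) _ _ _ Aud) vd).
  rewrite mulmx0 addr0 => H; apply: is_derive_eq H _.
  by rewrite [X in X + _](_ : _ = 0) ?add0r// dotpE !mxE !mul0r addr0.
rewrite (nabla_fieldE A x w Ad) (derive_basis A x w Ad) mulmx_suml.
rewrite /dotp [LHS](eq_bigr (fun k : 'I_2 =>
    w k 0 * dotp v ('D_(basis_vec k) A x *m v))).
  rewrite !big_ord2; move: ('D_(basis_vec 0) A x) ('D_(basis_vec 1) A x).
  by move=> D0 D1; rewrite !plane_simp; ring.
by move=> k _; rewrite mxE; have [_ ->] := Fd (basis_vec k).
Qed.

Lemma continuous_coord {T : topologicalType} {m n} (M : T -> 'M[R]_(m, n))
    (t : T) i j :
  {for t, continuous M} -> {for t, continuous (fun s => M s i j)}.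
Proof.
move=> Mc.
apply: (@continuous_comp _ _ _ M (fun N : 'M[R]_(m, n) => N i j)) => //.
exact: coord_continuous.
Qed.

Lemma continuous_dotp_mulmx (u v : R -> 'cV[R]_2) (M : R -> 'M[R]_2) (t : R) :
  {for t, continuous u} -> {for t, continuous v} -> {for t, continuous M} ->
  {for t, continuous (fun s => dotp (u s) (M s *m v s))}.
Proof.
move=> uc vc Mc.
rewrite (_ : (fun _ => _) = fun s =>
  u s 0 0 * (M s 0 0 * v s 0 0 + M s 0 1 * v s 1 0) +
  u s 1 0 * (M s 1 0 * v s 0 0 + M s 1 1 * v s 1 0)); last first.
  by apply/funext => s; rewrite !plane_simp.
by apply: continuousD; apply: continuousM; first [exact: continuous_coord|
  apply: continuousD; apply: continuousM; exact: continuous_coord].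
Qed.

(** [C1_field] gives continuity of the derivative for each fixed direction only, so the moving
    direction [w] is expanded in the two basis vectors. *)
Lemma continuous_nabla_field U A (c w : R -> 'cV[R]_2) (t : R) :
  C1_field U A -> (forall s, U (c s)) ->
  {for t, continuous c} -> {for t, continuous w} ->
  {for t, continuous (fun s => nabla_field A (c s) (w s))}.
Proof.
move=> AC1 Uc cc wc.
rewrite (_ : (fun _ => _) = fun s =>
    w s 0 0 *: 'D_(basis_vec 0) A (c s) +
    w s 1 0 *: 'D_(basis_vec 1) A (c s)); last first.
  apply/funext => s; have [Ad _] := AC1 _ (Uc s).
  by rewrite nabla_fieldE// derive_basis// big_ord2.
have Dc k : {for t, continuous (fun s => 'D_(basis_vec k) A (c s))}.
  have [_ /(_ (basis_vec k)) DA] := AC1 _ (Uc t).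
  exact: continuous_comp cc DA.
by apply: continuousD; apply: cvgZ => //; [exact: continuous_coord|exact: Dc|
  exact: continuous_coord|exact: Dc].
Qed.

End FieldCalculus.

(** * Continuous functions on the line and angles on the circle *)

Section LineAndCircle.
Context {R : realType}.
Implicit Types (f : R -> R) (u v w : 'cV[R]_2).

Lemma IVT_line f (a b v : R) : continuous f -> f a <= v <= f b ->
  exists c, f c = v.
Proof.
move=> fc fab.
have ivt (x y : R) : x <= y ->
    Num.min (f x) (f y) <= v <= Num.max (f x) (f y) -> exists c, f c = v.
  move=> xy vxy; have [||c _ fcv] := @IVT R f x y v xy => //.
    exact/continuous_subspaceT.
  by exists c.
move: fab => /andP[av vb].
by case: (leP a b) => [/ivt|/ltW/ivt]; apply; rewrite ge_min le_max av vb ?orbT.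
Qed.

Lemma sg_continuous_neq0 f (s t : R) : continuous f -> (forall x, f x != 0) ->
  Num.sg (f s) = Num.sg (f t).
Proof.
move=> fc f0.
have no x y : ~~ ((f x < 0) && (0 < f y)).
  apply/negP => /andP[x0 y0]; have [|z /eqP] := IVT_line _ x y 0 fc.
    by rewrite !ltW.
  by rewrite (negbTE (f0 z)).
have := no s t; have := no t s; have := f0 s; have := f0 t.
by case: (ltgtP (f s) 0) => // fs; case: (ltgtP (f t) 0) => // ft;
  rewrite ?(ltr0_sg fs) ?(gtr0_sg fs) ?(ltr0_sg ft) ?(gtr0_sg ft).
Qed.

(** Makes the range of a parameter change usable as the domain of a curve. It is open because f s
    lies strictly between f (s - 1) and f (s + 1). *)
Lemma is_derive_gt0_range_itv f (df : R -> R) :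
  (forall s : R, is_derive s 1 f (df s)) -> (forall s, 0 < df s) ->
  open (range f) /\ is_interval (range f).
Proof.
move=> fd df0.
have fc : continuous f by move=> s; exact: is_derive_continuous (fd s).
have fincr x y : x < y -> f x < f y.
  by apply: (@is_derive_gt0_itv_incr R setT f df).
have ritv : is_interval (range f).
  move=> _ _ [a _ <-] [b _ <-] u /(IVT_line _ _ _ _ fc)[c <-].
  by exists c.
split=> //; rewrite openE => _ [s _ <-].
apply: (@filterS _ _ _ [set u | f (s - 1) < u < f (s + 1)]).
  move=> u /andP[u1 u2]; apply: (ritv (f (s - 1)) (f (s + 1))).
  - by exists (s - 1).
  - by exists (s + 1).
  - by rewrite !ltW.
have s1 : f (s - 1) < f s by apply: fincr; rewrite ltrBlDr ltrDl.
have s2 : f s < f (s + 1) by apply: fincr; rewrite ltrDl.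
near=> u; apply/andP; split; near: u; [exact: lt_nbhsr|exact: lt_nbhsl].
Unshelve. all: by end_near. Qed.

Lemma is_derive_periodic {V : normedModType R} (c w : R -> V) (T : R) :
  (forall s : R, is_derive s 1 c (w s)) -> (forall s, c (s + T) = c s) ->
  forall s, w (s + T) = w s.
Proof.
move=> cd cT s.
have shiftd : is_derive s (1 : R) (fun t : R => t + T) (1 : R).
  exact: is_derive_add_cst.
have := is_derive_comp_curve c (fun t => t + T) s 1 _ (cd (s + T)) shiftd.
have -> : c \o (fun t => t + T) = c by apply/funext => t /=; exact: cT.
by rewrite scale1r => -[_ <-]; have [_ <-] := cd s.
Qed.

Lemma cos_periodicz (k : int) (a : R) : cos (a + k%:~R * (2 * pi)) = cos a.
Proof.
have nat_case (n : nat) b : cos (b + n%:R * (2 * pi)) = cos b :> R.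
  by rewrite mulr_natl mulr_natl; exact: (periodicn (@cosD2pi R)).
case: k => n; first exact: nat_case.
rewrite -[LHS](nat_case n.+1) NegzE; congr cos.
by rewrite mulrNz; ring.
Qed.

(** Remove from a - b the whole turns, and let y in [0, pi) be half of the remainder. Then cos (2 y)
    = 1, so sin y = 0, and positivity of the sine on (0, pi) leaves y = 0. *)
Lemma unit_vec_angle_eq (a b : R) : unit_vec a = unit_vec b -> angle_eq a b.
Proof.
move=> ab.
have cosab : cos a = cos b by have /matrixP/(_ 0 0) := ab; rewrite !mxE.
have sinab : sin a = sin b by have /matrixP/(_ 1 0) := ab; rewrite !mxE.
have pi2 : 0 < 2 * pi :> R by rewrite mulr_gt0// pi_gt0.
exists (Num.floor ((a - b) / (2 * pi))); set k := Num.floor _.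
have /andP[k1 k2] := floor_itv ((a - b) / (2 * pi)).
pose y := (a - b) / 2 - k%:~R * pi.
have y2 : a = b + k%:~R * (2 * pi) + 2 * y by rewrite /y; field.
have y0 : 0 <= y.
  move: k1; rewrite ler_pdivlMr// -/k => k1; rewrite /y; lra.
have ypi : y < pi.
  move: k2; rewrite ltr_pdivrMr// -/k intrD => k2; rewrite /y; lra.
have siny : sin y = 0.
  have : sin y ^+ 2 = 0.
    have : cos (2 * y) = 1.
      have -> : 2 * y = (a - b) + (- k)%:~R * (2 * pi).
        by rewrite y2 mulrNz; ring.
      by rewrite cos_periodicz cosB cosab sinab -!expr2 cos2Dsin2.
    rewrite mulr_natl cos_mulr2n cos2sin2; lra.
  by move/eqP; rewrite sqrf_eq0 => /eqP.
have : y = 0.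
  apply/eqP; rewrite eq_le y0 andbT leNgt; apply/negP => ygt0.
  have : 0 < sin y by apply: sin_gt0_pi; rewrite ygt0 ypi.
  by rewrite siny ltxx.
by move=> yE; rewrite y2 yE mulr0 addr0.
Qed.

(** The arc cosine of the first coordinate fixes the angle up to its sign, which is read off the
    second coordinate. *)
Lemma unit_vec_surj u : dotp u u = 1 -> exists phi, u = unit_vec phi.
Proof.
rewrite dotpE -!expr2 => u1.
have u0 : -1 <= u 0 0 <= 1.
  have := sqr_ge0 (u 1 0).
  have -> : u 1 0 ^+ 2 = 1 - u 0 0 ^+ 2 by rewrite -u1; ring.
  by move=> ?; apply/andP; split; nra.
have sin2 : sin (acos (u 0 0)) ^+ 2 = u 1 0 ^+ 2.
  by rewrite sin2cos2 acosK// -u1; ring.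
move/eqP: sin2; rewrite eqf_sqr => /orP[] /eqP sinE.
  by exists (acos (u 0 0)); apply: cV2P; rewrite mxE/= ?acosK.
exists (- acos (u 0 0)); apply: cV2P; rewrite mxE/= ?cosN ?acosK//.
by rewrite sinN sinE opprK.
Qed.

End LineAndCircle.

(** * Null directions, and from orbits to null-geodesics *)

Section NullDirections.
Context {R : realType} (U : set 'cV[R]_2) (A : 'cV[R]_2 -> 'M[R]_2) (alpha : R).
Hypothesis A_sym : forall x, U x -> (A x)^T = A x.
Hypothesis A_C1 : C1_field U A.

Lemma rot90K (u : 'cV[R]_2) : rot90 *m (rot90 *m u) = - u.
Proof. by apply: cV2P; rewrite !plane_simp. Qed.

Lemma shifted_sym x : U x -> (shifted A alpha x)^T = shifted A alpha x.
Proof. by move=> Ux; rewrite /shifted linearB/= A_sym// tr_scalar_mx. Qed.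

Lemma differentiable_field x : U x -> differentiable A x.
Proof. by move=> /A_C1[]. Qed.

(** The transpose of J moves to the other factor, and alpha may be inserted because e is orthogonal
    to J e. *)
Lemma transversalityE z : transversality A z =
  dotp (rot90 *m unit_vec z.2) (shifted A alpha z.1 *m unit_vec z.2).
Proof.
rewrite /transversality /shifted; move: (unit_vec z.2) (A z.1) => e B.
rewrite mulmxBl mul_scalar_mx -mulmxA.
have -> : rot90^T *m (B *m e) = - (rot90 *m (B *m e)).
  by apply: cV2P; rewrite !plane_simp !mxE/=; ring.
by rewrite !plane_simp; ring.
Qed.

Lemma metric_form_eq0 x v :
  (metric_form A alpha x v = 0) <-> (dotp v (shifted A alpha x *m v) = 0).
Proof.
rewrite /metric_form; split => [/eqP|->]; last by rewrite mulr0.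
by rewrite mulf_eq0 invr_eq0 pnatr_eq0/= => /eqP.
Qed.

Lemma null_direction_level x v phi rho : U x -> lorentzian_at A alpha x ->
  0 < rho -> v = rho *: unit_vec phi -> metric_form A alpha x v = 0 ->
  level_surface U A alpha (x, phi).
Proof.
move=> Ux [Bunit _] rho0 -> /metric_form_eq0; rewrite dotpZ => /eqP.
rewrite mulf_eq0 expf_eq0/= gt_eqF//= => /eqP eBe.
split; last exact/metric_form_eq0.
split=> //; rewrite transversalityE/=.
exact: unitmx_null_vector Bunit (dotp_unit_vec _) eBe.
Qed.

Lemma null_geodesic_lift_level (p : curve) : null_geodesic U A alpha p ->
  tangent_lift p `<=` level_surface U A alpha.
Proof.
move=> [geo null] [y phi] [s ps] [/= -> [rho rho0 vE]].
have [Us lor _ _ _] := geo _ ps; have [_ v0] := null _ ps.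
exact: null_direction_level rho0 vE v0.
Qed.

Lemma level_surface_lorentzian z : level_surface U A alpha z ->
  lorentzian_at A alpha z.1.
Proof.
move=> [[Uz tau0] /metric_form_eq0 eBe].
apply: (null_vector_lorentzian _ (unit_vec z.2)) => //.
- exact: shifted_sym.
- exact: dotp_unit_vec.
- by rewrite -transversalityE.
Qed.

Lemma level_surface_image z : level_surface U A alpha z ->
  shifted A alpha z.1 *m unit_vec z.2 =
  transversality A z *: (rot90 *m unit_vec z.2).
Proof.
move=> [_ /metric_form_eq0 eBe]; rewrite transversalityE.
by apply: null_vector_image => //; exact: dotp_unit_vec.
Qed.

(** By symmetry of the matrix the two terms containing w' are equal, whence the factor 2. The
    formula serves both directions: it shows that orbits preserve the null condition, and it
    determines the rotation rate of a null tangent. *)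
Lemma is_derive_metric (x w : R -> 'cV[R]_2) (s kappa : R) :
  U (x s) -> is_derive s 1 x (w s) ->
  is_derive s 1 w (kappa *: (rot90 *m w s)) ->
  is_derive s 1 (fun t => dotp (w t) (shifted A alpha (x t) *m w t))
    (2 * kappa * dotp (rot90 *m w s) (shifted A alpha (x s) *m w s) +
     dotp (w s) (nabla_field A (x s) (w s) *m w s)).
Proof.
move=> Us xd wd; have Ad := differentiable_field _ Us.
have Bd := is_derive_add_cst _ (- alpha%:M) _ _ _
  (is_derive_field _ _ _ _ Ad xd).
have := is_derive_dotp _ _ _ _ _ _ wd (is_derive_mulmx _ _ _ _ _ _ Bd wd).
move=> H; apply: is_derive_eq H _.
rewrite -/(shifted A alpha (x s)); have := shifted_sym _ Us.
move: (w s) (nabla_field _ _ _) (shifted _ _ _) => u N B /symmetric_offdiag B10.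
by rewrite !plane_simp B10; ring.
Qed.

Lemma ivp_level (x : R -> 'cV[R]_2) (phi : R -> R) :
  ivp_solution U A alpha x phi ->
  forall s, level_surface U A alpha (x s, phi s).
Proof.
move=> [[_ lev0] sol] s; have [dom _ _] := sol s; split => //.
apply/metric_form_eq0 => /=; move/metric_form_eq0 : lev0 => /= <-.
pose Q t := dotp (unit_vec (phi t)) (shifted A alpha (x t) *m unit_vec (phi t)).
apply: (@is_derive_0_is_cst _ Q) => t; have [[/= Ut tau0] xd phid] := sol t.
have ed := is_derive_unit_vec _ _ _ phid.
apply: (is_derive_eq (is_derive_metric _ _ _ _ Ut xd ed)).
(* The angular speed is exactly the kappa for which the two terms of the derivative cancel. *)
rewrite -(transversalityE (x t, phi t)) /angular_speed/=.
by field.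
Qed.

Lemma ivp_null_geodesic (x : R -> 'cV[R]_2) (phi : R -> R) :
  ivp_solution U A alpha x phi ->
  exists2 p, null_geodesic U A alpha p & reparam (line_curve x) p.
Proof.
move=> ivp; have lev := ivp_level _ _ ivp; have [_ sol] := ivp.
have Ux s : U (x s) by have [[]] := sol s.
have xd (s : R) : is_derive s 1 x (unit_vec (phi s)) by have [] := sol s.
have phid (s : R) : is_derive s 1 phi (angular_speed A (x s, phi s)).
  by have [] := sol s.
pose e s := unit_vec (phi s).
have ed (s : R) :
    is_derive s 1 e (angular_speed A (x s, phi s) *: (rot90 *m e s)).
  exact: is_derive_unit_vec.
have xc s : {for s, continuous x} by exact: is_derive_continuous (xd s).
have ec s : {for s, continuous e} by exact: is_derive_continuous (ed s).
have Jed (s : R) : is_derive s 1 (fun t => rot90 *m e t)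
    (rot90 *m (angular_speed A (x s, phi s) *: (rot90 *m e s))).
  have := is_derive_mulmx _ _ _ _ _ _ (is_derive_cst rot90 s 1) (ed s).
  by rewrite mul0mx add0r.
have Jec s : {for s, continuous (fun t => rot90 *m e t)}.
  exact: is_derive_continuous (Jed s).
pose tau s := transversality A (x s, phi s).
have tau_neq0 s : tau s != 0 by have [[]] := sol s.
have tauc : continuous tau.
  move=> s; rewrite (_ : tau = fun t => dotp (rot90 *m e t)
    (shifted A alpha (x t) *m e t)); last first.
    by apply/funext => t; rewrite /tau transversalityE.
  apply: continuous_dotp_mulmx (Jec s) (ec s) _.
  apply: (@is_derive_continuous _ _ _ _ (nabla_field A (x s) (e s))).
  apply: is_derive_add_cst; apply: is_derive_field => //.
  exact: differentiable_field.
(* For a curve of speed r, put m = r tau. With derivatives in arc length, the component of the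
   Euler-Lagrange equations along J e reads m' = h m, so m is a constant times exp H, where H' =
   h. *)
pose q2 s := dotp (e s) (nabla_field A (x s) (rot90 *m e s) *m e s).
pose h s := q2 s / (2 * tau s).
have hc : continuous h.
  move=> s; apply: continuousM.
    apply: continuous_dotp_mulmx (ec s) (ec s) _.
    exact: continuous_nabla_field A_C1 Ux (xc s) (Jec s).
  apply: (@continuousV _ _ (fun t => 2 * tau t)).
    by rewrite mulf_neq0.
  by apply: continuousM; [exact: cst_continuous|exact: tauc].
have [H Hd] := continuous_primitive _ hc.
have Hc : continuous H by move=> s; exact: is_derive_continuous (Hd s).
(* dT is the reciprocal of the speed of the null-geodesic. *)
pose dT s := `|tau s| * expR (- H s).
have dT_gt0 s : 0 < dT s by rewrite mulr_gt0 ?normr_gt0 ?expR_gt0.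
have dTc : continuous dT.
  move=> s.
  apply: (@continuousM _ _ (fun t => `|tau t|) (fun t => expR (- H t))).
    apply: continuous_comp; [exact: tauc|exact: norm_continuous].
  apply: (@continuous_comp _ _ _ (fun t => - H t) expR).
    exact: continuousN (Hc s).
  exact: continuous_expR.
(* [T] is the parameter of the null-geodesic as a function of the arc length of [x]. Its range, an
   open interval that may be bounded, becomes the domain, and the inverse [g] gives back the arc
   length. *)
have [T Td] := continuous_primitive _ dTc.
have [Eop Eitv] := is_derive_gt0_range_itv _ _ Td dT_gt0.
have E0 : range T !=set0 by exists (T 0), 0.
have [g [_ gT Tg gP]] := increasing_C1_inverse setT (range T) T dT openT
  (@is_intervalT R) erefl (fun s _ => And3 (Td s) (dT_gt0 s) (dTc s)).
pose p := Curve (x \o g) Eop Eitv E0.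
exists p; last first.
  apply: (reparamP _ _ T dT) => // [s _|].
    by split; [exact: Td|exact: dT_gt0|exact: dTc].
  by move=> s _; rewrite -[RHS]/(x (g (T s))) gT.
have gd (u : R) : range T u -> is_derive u 1 g (dT (g u))^-1 by move=> /gP[].
have pd (u : R) : range T u -> is_derive u 1 p ((dT (g u))^-1 *: e (g u)).
  by move=> /gd; apply: is_derive_comp_curve; exact: xd.
have velE u : range T u -> velocity p u = (dT (g u))^-1 *: e (g u).
  by move=> /pd[_ +]; rewrite /velocity derive1E.
(* The nonvanishing continuous [tau] keeps its sign. As r > 0, the same sign goes with m. *)
pose sgn := Num.sg (tau 0).
have sgnE s : sgn * `|tau s| = tau s.
  by rewrite /sgn (sg_continuous_neq0 _ 0 s tauc tau_neq0) -numEsg.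
(* The momentum m J e as a function of arc length, in a form that can be differentiated directly. *)
pose K s := (sgn * expR (H s)) *: (rot90 *m e s).
have momentumE u : range T u ->
    shifted A alpha (p u) *m velocity p u = K (g u).
  move=> Eu; rewrite velE// -scalemxAr (level_surface_image _ (lev (g u))).
  rewrite scalerA /K -/(tau _) -[in LHS](sgnE (g u)) /dT expRN; congr (_ *: _).
  have tn0 : `|tau (g u)| != 0 by rewrite normr_eq0.
  by field; rewrite tn0 gt_eqF// expR_gt0.
have Kd (s : R) : is_derive s 1 K
    ((sgn * (expR (H s) * h s)) *: (rot90 *m e s) +
    (sgn * expR (H s)) *:
      (rot90 *m (angular_speed A (x s, phi s) *: (rot90 *m e s)))).
  apply: is_derive_scale (Jed s).
have momd (u : R) : range T u -> is_derive u 1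
    (fun t => shifted A alpha (p t) *m velocity p t)
    ((dT (g u))^-1 *:
      ((sgn * (expR (H (g u)) * h (g u))) *: (rot90 *m e (g u)) +
    (sgn * expR (H (g u))) *:
      (rot90 *m (angular_speed A (x (g u), phi (g u)) *: (rot90 *m e (g u)))))).
  (* The momentum is known to equal [K \o g] on the range of [T] only, which is enough because that
     range is open. *)
  move=> Eu; apply: (@near_eq_is_derive _ _ _ (K \o g)).
    apply: (@filterS _ _ _ (range T)) => [t Et|]; first by rewrite momentumE.
    exact: open_nbhs_nbhs.
  exact: is_derive_comp_curve (Kd _) (gd _ Eu).
have lor u : lorentzian_at A alpha (p u).
  exact: level_surface_lorentzian (lev (g u)).
split=> [u Eu|u Eu]; last first.
  rewrite velE//; split.
    by rewrite scaler_eq0 negb_or invr_eq0 gt_eqF//= unit_vec_neq0.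
  apply/metric_form_eq0; rewrite dotpZ.
  have [_ /metric_form_eq0 ->] := lev (g u).
  by rewrite mulr0.
have [momd1 momE] := momd _ Eu; have [pd1 _] := pd _ Eu.
split; [exact: Ux|exact: lor|exact: pd1|exact: momd1|].
rewrite derive1E momE velE//=.
set s := g u; set r := (dT s)^-1; set G := gradient _ _.
have Ad := differentiable_field _ (Ux s).
have GE w : dotp w G = r ^+ 2 * dotp (e s) (nabla_field A (x s) w *m e s).
  by rewrite dotp_gradient// dotpZ.
(* In the frame (e, J e) the component along e reduces to the formula for phi', and the one along J
   e to the choice of [h]. *)
rewrite (frame_decomposition (e s) G (dotp_unit_vec _)) !GE -/(q2 s).
rewrite -scalemxAr rot90K.
have rE : sgn * expR (H s) = r * tau s.
  rewrite -[in RHS](sgnE s) /r /dT expRN.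
  have tn0 : `|tau s| != 0 by rewrite normr_eq0.
  by field; rewrite tn0 gt_eqF// expR_gt0.
rewrite mulrA rE /angular_speed/= -/(e s) -/(tau s) /h.
set q1 := dotp (e s) (nabla_field _ _ _ *m _).
have t0 := tau_neq0 s.
by apply: cV2P; rewrite !plane_simp [RHS]mxE; field.
Qed.

End NullDirections.

(** * From null-geodesics to orbits *)

Section ClosedCurves.
Context {R : realType}.

(** For symmetric B the matrix - J B J is the adjugate. This recovers a velocity from its momentum
    by a formula that can be differentiated. *)
Lemma scale_det_rot90 (B : 'M[R]_2) (v : 'cV[R]_2) : B^T = B ->
  \det B *: v = - (rot90 *m (B *m (rot90 *m (B *m v)))).
Proof.
move=> /symmetric_offdiag B10.
by apply: cV2P; rewrite !plane_simp det_mx2 B10; ring.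
Qed.

Lemma continuous_speed (w : R -> 'cV[R]_2) (s : R) :
  {for s, continuous w} ->
  {for s, continuous (fun t => Num.sqrt (dotp (w t) (w t)))}.
Proof.
move=> wc; apply: continuous_comp; last exact: sqrt_continuous.
rewrite (_ : (fun t => dotp (w t) (w t)) = fun t => dotp (w t) (1%:M *m w t)).
  apply: (@continuous_dotp_mulmx _ w w (fun=> 1%:M)) => //.
  exact: cst_continuous.
by apply/funext => t; rewrite mul1mx.
Qed.

(** Arc length [l] grows by the length [L] of one turn over each period [T]. It is therefore a
    bijection of the line, and its inverse turns the period [T] of [c] into the period [L] of
    [x]. *)
Lemma arc_length_parametrization (U : set 'cV[R]_2) (c : R -> 'cV[R]_2) :
  closed_regular_curve U c ->
  exists x w : R -> 'cV[R]_2,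
    [/\ reparam (line_curve c) (line_curve x), forall s, U (x s),
        forall s : R, is_derive s 1 x (w s),
        forall s, dotp (w s) (w s) = 1 /\ {for s, continuous w}
      & exists2 T, 0 < T & forall s, x (s + T) = x s].
Proof.
move=> [Uc creg c'c [T T0 cT]].
have cd (s : R) : is_derive s 1 c (c^`() s).
  by have [dc _] := creg s; exact: is_derive_derive1.
have c'T := is_derive_periodic _ _ _ cd cT.
pose n s := Num.sqrt (dotp (derive1 c s) (derive1 c s)).
have n0 s : 0 < n s by have [_ ?] := creg s; rewrite sqrtr_gt0 dotp_gt0.
have nc : continuous n by move=> s; apply: continuous_speed; exact: c'c.
have [l ld] := continuous_primitive _ nc.
have lc : continuous l by move=> s; exact: is_derive_continuous (ld s).
pose L := l T - l 0.
have L0 : 0 < L.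
  by rewrite subr_gt0; apply: (@is_derive_gt0_itv_incr _ setT l n).
have lT s : l (s + T) = l s + L.
  pose D t := l (t + T) - l t.
  suff : D s = D 0 by rewrite /D add0r -/L => <-; rewrite [RHS]addrC subrK.
  apply: is_derive_0_is_cst => t.
  have shiftd : is_derive t (1 : R) (fun u : R => u + T) (1 : R).
    exact: is_derive_add_cst.
  have lTd := is_derive_comp_curve l (fun u => u + T) t 1 _ (ld (t + T)) shiftd.
  apply: is_derive_eq (is_deriveB lTd (ld t)) _.
  by rewrite scale1r /n c'T subrr.
have lTn s k : l (s + k%:R * T) = l s + k%:R * L.
  elim: k => [|k IH]; first by rewrite !mul0r !addr0.
  by rewrite -natr1 mulrDl mul1r [in LHS]addrA lT IH mulrDl mul1r -addrA.
have lsurj : range l = [set: R].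
  apply/seteqP; split => // v _.
  (* Enough turns for l 0 - k L and l 0 + k L to enclose v. *)
  pose k := (Num.truncn (`|v - l 0| / L)).+1.
  have kL : `|v - l 0| < k%:R * L by rewrite -ltr_pdivrMr// truncnS_gt.
  move: kL; rewrite ltr_norml => /andP[k1 k2].
  have [||u lu] := IVT_line l (0 - k%:R * T) (0 + k%:R * T) v => //.
    have := lTn (0 - k%:R * T) k; rewrite subrK lTn => lk.
    by apply/andP; split; lra.
  by exists u.
have [g [_ gl lg gP]] := increasing_C1_inverse setT setT l n openT
  (@is_intervalT R) lsurj (fun s _ => And3 (ld s) (n0 s) (nc s)).
have gd (t : R) : is_derive t 1 g (n (g t))^-1 by have [] := gP t I.
pose w t := (n (g t))^-1 *: derive1 c (g t).
exists (c \o g), w; split.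
- apply: (reparamP _ _ l n) => // s _.
    by split; [exact: ld|exact: n0|exact: nc].
  by rewrite /= gl.
- by move=> s; exact: Uc.
- by move=> s; exact: is_derive_comp_curve (cd (g s)) (gd s).
- move=> s; split.
    have nn : n (g s) ^+ 2 = dotp (derive1 c (g s)) (derive1 c (g s)).
      by rewrite sqr_sqrtr// dotp_ge0.
    have := dotpZ (n (g s))^-1 1%:M (derive1 c (g s)).
    by rewrite !mul1mx -nn => ->; rewrite exprVn mulVf// expf_neq0// gt_eqF.
  have [_ _ nVc] := gP s I.
  apply: cvgZ; first exact: nVc.
  apply: continuous_comp (c'c (g s)).
  exact: is_derive_continuous (gd s).
- exists L => // s /=.
  have -> : g (s + L) = g s + T by rewrite -[in LHS](lg s I) -lT gl.
  exact: cT.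
Qed.

(** Differentiating <w, w> = 1 removes the component of [dw] along w. *)
Lemma is_derive_unit_perp (w : R -> 'cV[R]_2) (s : R) dw :
  (forall t, dotp (w t) (w t) = 1) -> is_derive s 1 w dw ->
  dw = dotp (rot90 *m w s) dw *: (rot90 *m w s).
Proof.
move=> w1 wd; have [_] := is_derive_dotp _ _ _ _ _ _ wd wd.
rewrite (_ : (fun _ => _) = cst 1); last by apply/funext => t; exact: w1.
rewrite derive_cst => /esym ww.
rewrite {1}(frame_decomposition (w s) dw)//.
suff -> : dotp (w s) dw = 0 by rewrite scale0r add0r.
by move: ww; rewrite !dotpE => ww; lra.
Qed.

(** With phi a primitive of kappa starting at an angle of w 0, both w and e_phi solve the linear
    equation u' = kappa J u. Their difference solves it too and has constant norm, as u is
    orthogonal to J u; it starts at 0 and so vanishes. *)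
Lemma angle_lift (w : R -> 'cV[R]_2) (kappa : R -> R) :
  continuous kappa -> dotp (w 0) (w 0) = 1 ->
  (forall s : R, is_derive s 1 w (kappa s *: (rot90 *m w s))) ->
  exists phi : R -> R, (forall s : R, is_derive s 1 phi (kappa s)) /\
    forall s, w s = unit_vec (phi s).
Proof.
move=> kc w01 wd.
have [Phi Phid] := continuous_primitive _ kc.
have [phi0 w0E] := unit_vec_surj _ w01.
pose phi s := Phi s + (phi0 - Phi 0).
have phid (s : R) : is_derive s 1 phi (kappa s).
  exact: is_derive_add_cst.
exists phi; split => // s.
pose u t := w t - unit_vec (phi t).
have ud (t : R) : is_derive t 1 u (kappa t *: (rot90 *m u t)).
  rewrite mulmxBr scalerBr.
  exact: is_deriveB (wd t) (is_derive_unit_vec _ _ _ (phid t)).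
have u0 : u 0 = 0 by rewrite /u /phi addrCA subrr addr0 w0E subrr.
have : dotp (u s) (u s) = dotp (u 0) (u 0).
  apply: (@is_derive_0_is_cst _ (fun t => dotp (u t) (u t))) => t.
  apply: is_derive_eq (is_derive_dotp _ _ _ _ _ _ (ud t) (ud t)) _.
  by rewrite !plane_simp; ring.
have [/eqP|us] := eqVneq (u s) 0; first by rewrite subr_eq0 => /eqP.
have := dotp_gt0 _ us; rewrite u0 => /[swap] ->.
by rewrite dotpE !mxE !mul0r addr0 ltxx.
Qed.

End ClosedCurves.

Section NullGeodesicOrbits.
Context {R : realType} (U : set 'cV[R]_2) (A : 'cV[R]_2 -> 'M[R]_2) (alpha : R).
Hypothesis A_sym : forall x, U x -> (A x)^T = A x.
Hypothesis A_C1 : C1_field U A.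

(** * Unit-speed reparametrizations of a null-geodesic *)

Section UnitSpeed.
Context (p : @curve R) (x w : R -> 'cV[R]_2).
Hypothesis p_null : null_geodesic U A alpha p.
Hypothesis px : reparam p (line_curve x).
Hypothesis x_U : forall s, U (x s).
Hypothesis xw : forall s : R, is_derive s 1 x (w s).
Hypothesis w_unit : forall s, dotp (w s) (w s) = 1.

Let B s := shifted A alpha (x s).

(** The chain rule for x = p o g: the unit tangent and the velocity of [p] differ by a positive
    factor, so null conditions pass from one to the other. *)
Lemma unit_speed_pullback : exists g dg : R -> R,
  forall s : R, [/\ curve_dom p (g s), is_derive s 1 g (dg s), 0 < dg s,
    x s = p (g s) & velocity p (g s) = (dg s)^-1 *: w s].
Proof.
have [g [dg [gE gP xpg]]] := reparam_exists _ _ (reparam_sym _ _ px).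
exists g, dg => s; have [gd dg0 _] := gP s I.
have pg t : curve_dom p (g t) by rewrite -gE; exists t.
have xE : x = p \o g by apply/funext => t; exact: xpg.
split=> //; first exact: xpg.
have [geo _] := p_null; have [_ _ pd _ _] := geo _ (pg s).
have vd : is_derive (g s) 1 p (velocity p (g s)).
  exact: is_derive_derive1.
have [_] := is_derive_comp_curve _ _ _ _ _ vd gd.
by rewrite -xE; have [_ ->] := xw s => ->; rewrite scalerK// gt_eqF.
Qed.

Lemma unit_speed_null s : dotp (w s) (B s *m w s) = 0 /\ B s \in unitmx.
Proof.
have [g [dg /(_ s)[pg _ dg0 xE vE]]] := unit_speed_pullback.
have [geo null] := p_null.
have [_ [Bunit _] _ _ _] := geo _ pg.
split; last by rewrite /B xE.
have [_ /metric_form_eq0] := null _ pg; rewrite vE dotpZ -xE => /eqP.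
by rewrite mulf_eq0 expf_eq0/= invr_eq0 gt_eqF//= => /eqP.
Qed.

Lemma is_derive_shifted_curve (s : R) : is_derive s 1 B (nabla_field A (x s) (w s)).
Proof.
apply: is_derive_add_cst; apply: is_derive_field (xw s).
exact: differentiable_field A_C1 _ (x_U s).
Qed.

(** The velocity [y] of [p], read in arc length, is the inverse of [B] applied to the differentiable
    momentum. Hence [y] is differentiable, and so is its normalization [w]. *)
Lemma unit_speed_derivable (s : R) : derivable w s 1.
Proof.
have [g [dg gP]] := unit_speed_pullback.
pose y t := (dg t)^-1 *: w t.
have [M Md] : exists M : R -> 'cV[R]_2, forall t,
    derivable M t 1 /\ M t = B t *m y t.
  exists ((fun t => shifted A alpha (p t) *m velocity p t) \o g) => t.
  have [pg gd _ xE vE] := gP t.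
  have [geo _] := p_null; have [_ _ _ /derivableP md _] := geo _ pg.
  split; first by have [] := is_derive_comp_curve _ _ _ _ _ md gd.
  by rewrite /= vE /B xE.
have yE t : y t = (\det (B t))^-1 *: - (rot90 *m (B t *m (rot90 *m M t))).
  have [_ Bunit] := unit_speed_null t; have [_ ->] := Md t.
  rewrite -scale_det_rot90; last exact: (shifted_sym U).
  by rewrite scalerK// -unitfE -unitmxE.
have [dy yd] : exists dy, is_derive s 1 y dy.
  rewrite (_ : y = fun t =>
      (\det (B t))^-1 *: - (rot90 *m (B t *m (rot90 *m M t)))); last first.
    by apply/funext.
  have Bd := is_derive_shifted_curve s; have [/derivableP Mds _] := Md s.
  have Jd := is_derive_cst (@rot90 R) s (1 : R).
  have JBJd := is_derive_mulmx _ _ _ _ _ _ Jd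
    (is_derive_mulmx _ _ _ _ _ _ Bd (is_derive_mulmx _ _ _ _ _ _ Jd Mds)).
  have /is_derive_mxP Bijd := Bd.
  have [ddet detd] : exists ddet, is_derive s 1 (fun t => \det (B t)) ddet.
    rewrite (_ : (fun t => _) = (fun t => B t 0 0 * B t 1 1) -
        (fun t => B t 0 1 * B t 1 0)); last first.
      by apply/funext => t; rewrite det_mx2.
    by eexists; apply: is_deriveB; apply: is_derive_mul.
  have det0 : \det (B s) != 0.
    by have [_] := unit_speed_null s; rewrite unitmxE unitfE.
  by eexists; apply: is_derive_scale (is_deriveV det0 detd) (is_deriveN JBJd).
have dg0 t : 0 < dg t by have [] := gP t.
have y2 t : Num.sqrt (dotp (y t) (y t)) = (dg t)^-1.
  have := dotpZ (dg t)^-1 1%:M (w t); rewrite !mul1mx w_unit mulr1 => ->.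
  by rewrite sqrtr_sqr gtr0_norm// invr_gt0.
(* The factor [dg] is only known to be continuous, so it is expressed through the norm of [y]. *)
have wE : w = fun t => (Num.sqrt (dotp (y t) (y t)))^-1 *: y t.
  by apply/funext => t; rewrite y2 scalerA invrK mulfV ?scale1r// gt_eqF.
have yy0 : 0 < dotp (y s) (y s).
  by rewrite -sqrtr_gt0 y2 invr_gt0.
have sqd := is_derive1_comp (is_derive1_sqrt yy0)
  (is_derive_dotp _ _ _ _ _ _ yd yd).
have sq0 : (Num.sqrt \o (fun t => dotp (y t) (y t))) s != 0.
  by rewrite /= sqrtr_eq0 -ltNge.
rewrite wE.
by have [] := is_derive_scale _ _ _ _ _ _ (is_deriveV sq0 sqd) yd.
Qed.

Lemma unit_speed_curvature (s : R) :
  let tau := dotp (rot90 *m w s) (B s *m w s) in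
  tau != 0 /\
  is_derive s 1 w
    (- (dotp (w s) (nabla_field A (x s) (w s) *m w s) / (2 * tau)) *:
      (rot90 *m w s)).
Proof.
move=> tau; have [wBw Bunit] := unit_speed_null s.
have tau0 : tau != 0 by exact: unitmx_null_vector.
split=> //; have /derivableP wd := unit_speed_derivable s.
move: (is_derive_unit_perp _ _ _ w_unit wd) (wd).
set kappa := dotp _ _ => dwE; rewrite dwE => {}wd.
(* The form vanishes identically along the curve, so its derivative is 0; this is a linear equation
   for [kappa], solvable as [tau] is nonzero. *)
have [_] := is_derive_metric _ _ alpha A_sym A_C1 _ _ _ _ (x_U s) (xw s) wd.
rewrite (_ : (fun _ => _) = cst 0); last first.
  by apply/funext => t; have [] := unit_speed_null t.
rewrite derive_cst -/(B s) -/tau => /esym/eqP; rewrite addr_eq0 => /eqP kE.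
suff -> : - (dotp (w s) (nabla_field A (x s) (w s) *m w s) / (2 * tau)) = kappa.
  by [].
by rewrite -mulNr -kE; field.
Qed.

Lemma unit_speed_orbit : (forall s, {for s, continuous w}) ->
  exists phi : R -> R, ivp_solution U A alpha x phi /\
    forall s, w s = unit_vec (phi s).
Proof.
move=> wc.
pose tau s := dotp (rot90 *m w s) (B s *m w s).
pose kappa s :=
  - (dotp (w s) (nabla_field A (x s) (w s) *m w s) / (2 * tau s)).
have tau0 s : tau s != 0 by have [] := unit_speed_curvature s.
have xc s : {for s, continuous x} by exact: is_derive_continuous (xw s).
have Jwc s : {for s, continuous (fun t => rot90 *m w t)}.
  have [_ wd] := unit_speed_curvature s.
  exact: is_derive_continuous
    (is_derive_mulmx _ _ _ _ _ _ (is_derive_cst (@rot90 R) s (1 : R)) wd).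
(* Integrating the rotation rate requires its continuity, which rests on the continuous derivatives
   of A. *)
have kc : continuous kappa.
  move=> s; pose q t := dotp (w t) (nabla_field A (x t) (w t) *m w t).
  apply: (@continuousN _ _ _ (fun t => q t / (2 * tau t))).
  apply: (@continuousM _ _ q (fun t => (2 * tau t)^-1)).
    apply: continuous_dotp_mulmx (wc s) (wc s) _.
    exact: continuous_nabla_field A_C1 x_U (xc s) (wc s).
  apply: (@continuousV _ _ (fun t => 2 * tau t)); first by rewrite mulf_neq0.
  apply: continuousM; first exact: cst_continuous.
  apply: continuous_dotp_mulmx (Jwc s) (wc s) _.
  exact: is_derive_continuous (is_derive_shifted_curve s).
have [|phi [phid wE]] := angle_lift w kappa kc (w_unit 0).
  by move=> s; have [] := unit_speed_curvature s.
have tauE s : transversality A (x s, phi s) = tau s.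
  by rewrite (transversalityE _ alpha)/= -wE.
exists phi; split => //; split.
  split; first by split; [exact: x_U|rewrite tauE].
  by apply/metric_form_eq0; rewrite /= -wE; have [] := unit_speed_null 0.
move=> s; split; first by split; [exact: x_U|rewrite tauE].
  by rewrite -wE; exact: xw.
by rewrite /angular_speed tauE/= -wE; exact: phid.
Qed.

End UnitSpeed.

(** * The two inclusions for closed curves *)

Lemma closed_null_geodesics_orbits :
  closed_null_geodesics U A alpha `<=` closed_orbit_projections U A alpha.
Proof.
move=> _ [p [pnull -> [c creg pc]]].
have [x [w [cx Ux xw w1 [T T0 xT]]]] := arc_length_parametrization _ _ creg.
have px := reparam_trans _ _ _ pc cx.
have w_unit s := (w1 s).1.
have [phi [ivp wE]] := unit_speed_orbit _ _ _ pnull px Ux xw w_unit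
  (fun s => (w1 s).2).
exists x, phi; split; last exact: oriented_curve_eq.
split=> //; exists T => // s; split; first exact: xT.
(* The angle itself may change by whole turns over a period; the tangent vector is periodic because
   [x] is. *)
apply: unit_vec_angle_eq; rewrite -!wE.
exact: (is_derive_periodic _ _ _ xw xT).
Qed.

Lemma orbits_closed_null_geodesics :
  closed_orbit_projections U A alpha `<=` closed_null_geodesics U A alpha.
Proof.
move=> _ [x [phi [[ivp [T T0 xT]] ->]]].
have [p pnull xp] := ivp_null_geodesic _ _ _ A_sym A_C1 _ _ ivp.
have [_ sol] := ivp.
have x'E (s : R) : derive1 x s = unit_vec (phi s).
  by rewrite derive1E; have [_ [_ ->] _] := sol s.
exists p; split => //; first exact: oriented_curve_eq.
(* The geodesic parameter of [p] need not be periodic, so the closed regular representative is the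
   orbit [x] itself. *)
exists x; last exact: reparam_refl.
split.
- by move=> s; have [[]] := sol s.
- move=> s; rewrite x'E unit_vec_neq0; split => //.
  by have [_ [dx _] _] := sol s.
- rewrite (_ : derive1 x = fun s => unit_vec (phi s)); last exact/funext.
  move=> s; have [_ _ phid] := sol s.
  exact: is_derive_continuous (is_derive_unit_vec _ _ _ phid).
- by exists T => // s; have [] := xT s.
Qed.

End NullGeodesicOrbits.

Theorem theorem2 (R : realType) (U : set 'cV[R]_2) (A : 'cV[R]_2 -> 'M[R]_2)
    (U_open : open U)
    (A_sym : forall x, U x -> (A x)^T = A x)
    (A_C1 : C1_field U A)
    (alpha : R) :
  closed_null_geodesics U A alpha = closed_orbit_projections U A alpha /\
  (forall x : curve, null_geodesic U A alpha x ->
     tangent_lift x `<=` level_surface U A alpha).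
Proof.
split; last exact: null_geodesic_lift_level.
apply/seteqP; split.
  exact: closed_null_geodesics_orbits.
exact: orbits_closed_null_geodesics.
Qed.
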